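(* Let $(M^{2n+1},\phi,\xi,\eta,g)$ be a Sasakian manifold foliated by a flat Legendrian foliation $\mathcal F$, with $L=T\mathcal F$, such that the conjugate Legendrian distribution $Q=\phi L$ is integrable. Let $\nabla$ be the bi-Legendrian connection associated to $(L,Q)$ and suppose that $\nabla g=0$. Let $\hat\nabla$ be the Levi Civita connection of $g$ and let $S$ be the tensor field of type $(1,2)$ defined by $S(V,W)=\nabla_VW-\hat\nabla_VW$. Then $S(V,\xi)=S(\xi,V)=\phi V$ for all $V\in\Gamma(TM^{2n+1})$ and $S(Z,Z')=d\eta(Z,Z')\xi$ for all $Z,Z'\in\Gamma(\mathcal D)$. In particular, for all $X,X'\in\Gamma(L)$ and all $Y,Y'\in\Gamma(Q)$, $$\nabla_XX'=\hat\nabla_XX',\qquad \nabla_YY'=\hat\nabla_YY'.$$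
   Context: All manifolds are smooth and connected; $\Gamma(\cdot)$ denotes smooth sections. Convention: $2d\eta(V,W)=V(\eta(W))-W(\eta(V))-\eta([V,W])$. A contact form on $M^{2n+1}$ is a 1-form $\eta$ with $\eta\wedge(d\eta)^n\neq0$ everywhere; its Reeb vector field $\xi$ is determined by $\eta(\xi)=1$, $d\eta(\xi,\cdot)=0$; $\mathcal D=\ker\eta$. A contact metric structure $(\phi,\xi,\eta,g)$ consists of a contact form $\eta$ with Reeb field $\xi$, a Riemannian metric $g$ with $g(V,\xi)=\eta(V)$ and a $(1,1)$-tensor $\phi$ with $\phi^2=-I+\eta\otimes\xi$ and $d\eta(V,W)=g(V,\phi W)$. The manifold is Sasakian if $[\phi,\phi]+2d\eta\otimes\xi=0$, equivalently $(\hat\nabla_V\phi)W=g(V,W)\xi-\eta(W)V$ for all $V,W$. A Legendrian distribution is an $n$-dimensional subbundle $L\subset\mathcal D$ with $d\eta(X,X')=0$ for all $X,X'\in\Gamma(L)$; it is flat if $[\xi,X]\in\Gamma(L)$ for all $X\in\Gamma(L)$. A (flat) Legendrian foliation is a foliation whose tangent bundle is a (flat) Legendrian distribution. The conjugate $Q=\phi L$ is again Legendrian and $TM=L\oplus Q\oplus\mathbb R\xi$ orthogonally. Subscripts denote projections onto the corresponding subbundles. Bi-Legendrian connection of a pair $(L_1,L_2)$ of transversal Legendrian distributions (so $TM=L_1\oplus L_2\oplus\mathbb R\xi$): for vector fields $V,W$ let $H(V,W)\in\Gamma(\mathcal D)$ be the unique section with $d\eta(H(V,W),Z)=V(d\eta(W,Z))-d\eta(W,[V,Z])$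 for all $Z\in\Gamma(\mathcal D)$. Then for $X\in\Gamma(L_1)$, $Y\in\Gamma(L_2)$, $f\in C^\infty(M)$ and any vector field $W$, $\nabla_WX=H(W_{L_1},X)_{L_1}+[W_{L_2},X]_{L_1}+[W_{\mathbb R\xi},X]_{L_1}$, $\nabla_WY=H(W_{L_2},Y)_{L_2}+[W_{L_1},Y]_{L_2}+[W_{\mathbb R\xi},Y]_{L_2}$, $\nabla_W(f\xi)=W(f)\xi$. It preserves $L_1,L_2,\mathbb R\xi$, satisfies $\nabla d\eta=0$, $\nabla\xi=0$, and its torsion satisfies $T(X,Y)=2d\eta(X,Y)\xi$ for $X\in\Gamma(L_1),Y\in\Gamma(L_2)$ and $T(V,\xi)=[\xi,V_{L_1}]_{L_2}+[\xi,V_{L_2}]_{L_1}$ for all $V$. *)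

(* Defs.v *)
From HB Require Import structures.
From mathcomp Require Import all_boot all_order all_algebra all_fingroup.
From mathcomp Require Import ring.
From mathcomp Require Import all_classical all_reals all_analysis.
Set Implicit Arguments.
Unset Strict Implicit.
Unset Printing Implicit Defensive.
Import Order.TTheory GRing.Theory Num.Theory numFieldNormedType.Exports.
Local Open Scope classical_set_scope.
Local Open Scope ring_scope.

Section SmoothEuclidean.
Context {R : realType} {m : nat}.
Implicit Types (U : set 'rV[R]_m) (h : 'rV[R]_m -> R).

Fixpoint Ck (k : nat) U h : Prop :=
  (forall x, U x -> {for x, continuous h}) /\
  if k is k'.+1 then
    forall i : 'I_m, (forall x, U x -> derivable h x 'e_i) /\
      Ck k' U (fun x => 'D_('e_i) h x)
  else True.

Definition smoothE U h : Prop := forall k, Ck k U h.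

Lemma Ck_cont k U h : Ck k U h -> forall x, U x -> {for x, continuous h}.
Proof. by case: k => [|k] []. Qed.

Lemma CkW k U h : Ck k.+1 U h -> Ck k U h.
Proof.
elim: k h => [|k IH] h [c d]; split=> // i.
by have [d1 d2] := d i; split=> //; apply: IH.
Qed.

Lemma Ck_sub k U U' h : U' `<=` U -> Ck k U h -> Ck k U' h.
Proof.
move=> sU; elim: k h => [|k IH] h [c d]; first by split=> // x /sU/c.
split=> [x /sU/c//|i].
by have [d1 d2] := d i; split=> [x /sU/d1//|]; apply: IH.
Qed.

Lemma Ck_ext k U h1 h2 :
  open U -> (forall x, U x -> h1 x = h2 x) -> Ck k U h1 -> Ck k U h2.
Proof.
move=> oU; elim: k h1 h2 => [|k IH] h1 h2 e C.
all: have n x : U x -> \forall y \near x, h1 y = h2 y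
  by move=> Ux; near=> y; apply: e; near: y; exact: open_nbhs_nbhs.
all: have c x : U x -> {for x, continuous h2}
  by move=> Ux; rewrite /prop_for /continuous_at -(e x)//;
     apply: cvg_trans (Ck_cont C Ux); exact: (near_eq_cvg (n x Ux)).
  by [].
split=> // i; have [d1 d2] := C.2 i; split=> [x Ux|].
  exact: near_eq_derivable (n x Ux) (d1 x Ux).
by apply: IH d2 => x Ux; exact: near_eq_derive (n x Ux).
Unshelve. all: by end_near. Qed.

Lemma Ck_cst k U (a : R) : Ck k U (cst a).
Proof.
elim: k a => [|k IH] a; first by split=> // x _; exact: cst_continuous.
split=> [x _|i]; first exact: cst_continuous.
split=> [x _|]; first exact: derivable_cst.
rewrite (_ : (fun x => _) = cst 0); first exact: IH.
by apply/funext => x; rewrite derive_cst.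
Qed.

Lemma CkD k U h1 h2 : open U -> Ck k U h1 -> Ck k U h2 -> Ck k U (h1 \+ h2).
Proof.
move=> oU; elim: k h1 h2 => [|k IH] h1 h2 [c1 d1] [c2 d2].
  by split=> // x Ux; exact: (continuousD (c1 x Ux) (c2 x Ux)).
split=> [x Ux|i]; first by exact: (continuousD (c1 x Ux) (c2 x Ux)).
have [a1 b1] := d1 i; have [a2 b2] := d2 i; split=> [x Ux|].
  by apply: derivableD; [exact: a1|exact: a2].
apply: (Ck_ext oU _ (IH _ _ b1 b2)) => x Ux /=.
by rewrite deriveD//; [exact: a1|exact: a2].
Qed.

Lemma CkM k U h1 h2 : open U -> Ck k U h1 -> Ck k U h2 -> Ck k U (h1 \* h2).
Proof.
move=> oU; elim: k h1 h2 => [|k IH] h1 h2 C1 C2;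
  have [c1 d1] := C1; have [c2 d2] := C2.
  by split=> // x Ux; exact: (continuousM (c1 x Ux) (c2 x Ux)).
split=> [x Ux|i]; first by exact: (continuousM (c1 x Ux) (c2 x Ux)).
have [a1 b1] := d1 i; have [a2 b2] := d2 i; split=> [x Ux|].
  by apply: derivableM; [exact: a1|exact: a2].
apply: (Ck_ext oU _ (CkD oU (IH _ _ (CkW C1) b2) (IH _ _ (CkW C2) b1))).
by move=> x Ux /=; rewrite deriveM//; [exact: a1|exact: a2].
Qed.

End SmoothEuclidean.

Section Manifold.
Context {R : realType} {m : nat}.

Record chart (T : topologicalType) := Chart {
  chart_dom : set T;
  fwd : T -> 'rV[R]_m;
  bwd : 'rV[R]_m -> T }.

Definition is_chart (T : topologicalType) (c : chart T) : Prop :=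
  [/\ open (chart_dom c), open (fwd c @` chart_dom c),
      forall x, chart_dom c x -> bwd c (fwd c x) = x,
      forall x, chart_dom c x -> {for x, continuous (fwd c)} &
      forall y, (fwd c @` chart_dom c) y -> {for y, continuous (bwd c)}].

Definition compatible (T : topologicalType) (c1 c2 : chart T) : Prop :=
  forall j : 'I_m, smoothE (fwd c1 @` (chart_dom c1 `&` chart_dom c2))
                           (fun y => fwd c2 (bwd c1 y) 0 j).
End Manifold.
Arguments chart R m T : clear implicits.

Record manifold (R : realType) (m : nat) := Manifold {
  carrier :> topologicalType;
  manifold_hausdorff : hausdorff_space carrier;
  manifold_second_countable : @second_countable carrier;
  manifold_connected : connected [set: carrier];
  atlas : set (chart R m carrier);
  atlas_chart : forall c, atlas c -> is_chart c;
  atlas_cover : forall p, exists2 c, atlas c & chart_dom c p;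
  atlas_compatible : forall c1 c2, atlas c1 -> atlas c2 -> compatible c1 c2 }.

Section SmoothFunctions.
Context {R : realType} {m : nat} {M : manifold R m}.

Definition maximal_atlas (c : chart R m M) : Prop :=
  is_chart c /\ forall c', atlas c' -> compatible c c' /\ compatible c' c.

Definition smooth_on (A : set M) (f : M -> R) : Prop :=
  forall c, atlas c -> smoothE (fwd c @` (chart_dom c `&` A)) (f \o bwd c).

Definition smooth_at (p : M) (f : M -> R) : Prop :=
  exists2 A, open_nbhs p A & smooth_on A f.

Lemma open_chart (c : chart R m M) (A : set M) :
  atlas c -> open A -> open (fwd c @` (chart_dom c `&` A)).
Proof.
move=> /atlas_chart [oD oI K cf cb] oA.
rewrite (_ : _ @` _ = (fwd c @` chart_dom c) `&` (bwd c @^-1` A)).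
  move: oI; rewrite !openE => oI y [Iy Ay]; apply: filterI; first exact: oI.
  by apply: (cb y Iy); exact: open_nbhs_nbhs.
apply/seteqP; split=> [_ [x [dx Ax] <-]|_ [[x dx <-]] /=].
  by split; [exists x|rewrite /= K].
by rewrite K// => Ax; exists x.
Qed.

Lemma smooth_on_sub (A B : set M) f : B `<=` A -> smooth_on A f -> smooth_on B f.
Proof.
move=> BA s c ac k; apply: Ck_sub (s c ac k).
by move=> _ [x [dx Bx] <-]; exists x => //; split=> //; exact: BA.
Qed.

Lemma smooth_at_near p f : smooth_at p f -> \forall q \near p, smooth_at q f.
Proof.
move=> [A [oA Ap] sA].
by apply: filterS (open_nbhs_nbhs (conj oA Ap)) => q Aq; exists A.
Qed.

Lemma smooth_at_local p f g :
  smooth_at p f -> (\forall q \near p, f q = g q) -> smooth_at p g.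
Proof.
move=> [A [oA Ap] sA] fg.
have : nbhs p [set q | f q = g q] by exact: fg.
rewrite nbhsE => -[B [oB Bp] sB].
exists (A `&` B); first by split=> //; exact: openI.
move=> c ac k; apply: (@Ck_ext _ _ _ _ (f \o bwd c)).
- by apply: open_chart => //; exact: openI.
- move=> _ [x [dx [Ax Bx]] <-] /=; have [_ _ K _ _] := atlas_chart ac.
  by rewrite K//; exact: sB.
- by apply: (smooth_on_sub _ sA) => // x [].
Qed.

Lemma smooth_at_cst p (a : R) : smooth_at p (cst a).
Proof. by exists setT; [split=> //; exact: openT|move=> c _ k; exact: Ck_cst]. Qed.

Lemma smooth_at2 (op : (M -> R) -> (M -> R) -> M -> R) :
  (forall A f g, open A -> smooth_on A f -> smooth_on A g ->
    smooth_on A (op f g)) ->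
  forall p f g, smooth_at p f -> smooth_at p g -> smooth_at p (op f g).
Proof.
move=> H p f g [A [oA Ap] sA] [B [oB Bp] sB]; exists (A `&` B).
  by split; [exact: openI|].
apply: H; first exact: openI.
  by apply: smooth_on_sub sA => x [].
by apply: smooth_on_sub sB => x [].
Qed.

Lemma smooth_atD p f g : smooth_at p f -> smooth_at p g -> smooth_at p (f + g).
Proof.
apply: smooth_at2 => A f' g' oA sf sg c ac k.
exact: (CkD (open_chart ac oA) (sf c ac k) (sg c ac k)).
Qed.

Lemma smooth_atM p f g : smooth_at p f -> smooth_at p g -> smooth_at p (f * g).
Proof.
apply: smooth_at2 => A f' g' oA sf sg c ac k.
exact: (CkM (open_chart ac oA) (sf c ac k) (sg c ac k)).
Qed.

Lemma smooth_atZ p a f : smooth_at p f -> smooth_at p (a *: f).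
Proof. exact: (smooth_atM (smooth_at_cst p a)). Qed.

Lemma smooth_atN p f : smooth_at p f -> smooth_at p (- f).
Proof. by rewrite -scaleN1r; exact: smooth_atZ. Qed.

Lemma smooth_atB p f g : smooth_at p f -> smooth_at p g -> smooth_at p (f - g).
Proof. by move=> sf sg; apply: smooth_atD => //; exact: smooth_atN. Qed.

Definition smooth_pred : pred (M -> R) := fun f => `[< forall p, smooth_at p f >].

Lemma smooth_subring : subring_closed smooth_pred.
Proof.
split=> [|f g /asboolP sf /asboolP sg|f g /asboolP sf /asboolP sg].
- by apply/asboolP => p; exact: smooth_at_cst.
- by apply/asboolP => p; exact: smooth_atB.
- by apply/asboolP => p; exact: smooth_atM.
Qed.

Lemma smooth_submod : submod_closed smooth_pred.
Proof.
split=> [|a f g /asboolP sf /asboolP sg]; first by apply/asboolP => p; exact: smooth_at_cst.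
by apply/asboolP => p; apply: smooth_atD => //; exact: smooth_atZ.
Qed.

End SmoothFunctions.

Record Cinf (R : realType) (m : nat) (M : manifold R m) := MkCinf {
  Cinf_val :> M -> R;
  Cinf_proof : smooth_pred Cinf_val }.

Section CinfAlgebra.
Context {R : realType} {m : nat} {M : manifold R m}.
HB.instance Definition _ := [isSub for @Cinf_val R m M].
HB.instance Definition _ := [Choice of Cinf M by <:].
HB.instance Definition _ := GRing.SubChoice_isSubComPzRing.Build
  (M -> R) (@smooth_pred R m M) (Cinf M) smooth_subring.
HB.instance Definition _ := GRing.SubZmodule_isSubLmodule.Build
  R (M -> R) (@smooth_pred R m M) (Cinf M) smooth_submod.

Lemma Cinf_smooth (f : Cinf M) p : smooth_at p f.
Proof. by have /asboolP := Cinf_proof f. Qed.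

Definition mkCinf (f : M -> R) (sf : forall p, smooth_at p f) : Cinf M :=
  MkCinf (introT (asboolP _) sf).
End CinfAlgebra.

Section Tangent.
Context {R : realType} {m : nat} {M : manifold R m}.

(* A tangent vector at [p] is a derivation of the algebra of germs at [p] of
   smooth functions. It is represented on total functions, with value 0 on
   those that are not smooth near [p]; that the value depends on the germ only
   follows from the Leibniz rule applied to indicator functions. *)
Definition derivation_at (p : M) (v : (M -> R) -> R) : Prop :=
  [/\ forall f, ~ smooth_at p f -> v f = 0,
      forall a f g, smooth_at p f -> smooth_at p g ->
        v (a *: f + g) = a * v f + v g &
      forall f g, smooth_at p f -> smooth_at p g ->
        v (f * g) = v f * g p + f p * v g].

Definition derivation_pred (p : M) : pred ((M -> R) -> R) :=
  fun v => `[< derivation_at p v >].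

Lemma derivation_submod p : submod_closed (derivation_pred p).
Proof.
split=> [|a v w /asboolP[v0 vL vM] /asboolP[w0 wL wM]]; apply/asboolP.
  by split=> // *; rewrite !fctE ?mulr0 ?mul0r ?addr0.
split=> [f nf|b f g sf sg|f g sf sg]; rewrite !fctE.
- by rewrite v0// w0// scaler0 addr0.
- by rewrite vL// wL// /GRing.scale /=; ring.
- by rewrite vM// wM// /GRing.scale /=; ring.
Qed.
End Tangent.

Record tangent (R : realType) (m : nat) (M : manifold R m) (p : M) := MkTangent {
  tangent_val :> (M -> R) -> R;
  tangent_proof : derivation_pred p tangent_val }.

Section TangentSpace.
Context {R : realType} {m : nat} {M : manifold R m} (p : M).
HB.instance Definition _ := [isSub for @tangent_val R m M p].
HB.instance Definition _ := [Choice of tangent p by <:].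
HB.instance Definition _ := GRing.SubChoice_isSubLmodule.Build
  R ((M -> R) -> R) (@derivation_pred R m M p) (tangent p)
  (derivation_submod p).

Lemma tangentP (v w : tangent p) : (forall f, smooth_at p f -> v f = w f) -> v = w.
Proof.
move=> e; apply/val_inj/funext => f /=; have [sf|nf] := pselect (smooth_at p f).
  exact: e.
have /asboolP[v0 _ _] := tangent_proof v; have /asboolP[w0 _ _] := tangent_proof w.
by rewrite v0// w0.
Qed.

Lemma tangent_linear (v : tangent p) a f g : smooth_at p f -> smooth_at p g ->
  v (a *: f + g) = a * v f + v g.
Proof. by have /asboolP[_ + _] := tangent_proof v; apply. Qed.

Lemma tangentD (v : tangent p) f g : smooth_at p f -> smooth_at p g ->
  v (f + g) = v f + v g.
Proof. by move=> sf sg; rewrite -{1}[f]scale1r tangent_linear// mul1r. Qed.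

Lemma tangent_leibniz (v : tangent p) f g : smooth_at p f -> smooth_at p g ->
  v (f * g) = v f * g p + f p * v g.
Proof. by have /asboolP[_ _] := tangent_proof v; apply. Qed.

Lemma tangent_local (v : tangent p) f g : smooth_at p f ->
  (\forall q \near p, f q = g q) -> v f = v g.
Proof.
move=> sf fg; have sg := smooth_at_local sf fg.
have [A [oA Ap] eA] : exists2 A, open_nbhs p A & forall q, A q -> f q = g q.
  have : nbhs p [set q | f q = g q] by exact: fg.
  by rewrite nbhsE => -[A oA sA]; exists A.
pose chi : M -> R := \1_(~` A).
have chi0 q : A q -> chi q = 0.
  by move=> Aq; rewrite /chi indicE memNset//=; exact.
have schi : smooth_at p chi.
  apply: (smooth_at_local (smooth_at_cst p 0)).
  by near=> q; rewrite chi0//; near: q; exact: open_nbhs_nbhs.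
have e : f - g = (f - g) * chi.
  apply/funext => q; rewrite !fctE; have [Aq|nAq] := pselect (A q).
    by rewrite chi0// eA// subrr mulr0.
  by rewrite /chi indicE mem_set// mulr1.
have : v (f - g) = 0.
  rewrite e tangent_leibniz//; last exact: smooth_atB.
  by rewrite chi0// mulr0 !fctE eA// subrr mul0r addr0.
rewrite addrC -scaleN1r tangent_linear// mulN1r addrC.
by move/eqP; rewrite subr_eq0 => /eqP.
Unshelve. all: by end_near. Qed.
End TangentSpace.

Section VectorFields.
Context {R : realType} {m : nat} {M : manifold R m}.

(* [V] need not be smooth outside [A]. *)
Definition smooth_section_on (A : set M) (V : forall p : M, tangent p) : Prop :=
  forall p f, A p -> smooth_at p f -> smooth_at p (fun q => V q f).

Record vfield := MkVfield {
  vfield_at :> forall p : M, tangent p;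
  vfield_smooth : smooth_section_on setT vfield_at }.

Lemma vfieldP (V W : vfield) : (forall p, V p = W p) -> V = W.
Proof.
case: V W => [V sV] [W sW] /= e; have {e}e : V = W by apply: functional_extensionality_dep.
by subst W; congr MkVfield; exact: Prop_irrelevance.
Qed.

HB.instance Definition _ := gen_eqMixin vfield.
HB.instance Definition _ := gen_choiceMixin vfield.

Definition vfield0 : vfield :=
  @MkVfield (fun p => 0) (fun p f _ _ => smooth_at_cst p 0).

Lemma vfieldN_smooth (V : vfield) : smooth_section_on setT (fun p => - V p).
Proof. by move=> p f _ sf; apply: smooth_atN; exact: vfield_smooth. Qed.
Definition vfieldN (V : vfield) : vfield := MkVfield (vfieldN_smooth V).

Lemma vfieldD_smooth (V W : vfield) :
  smooth_section_on setT (fun p => V p + W p).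
Proof. by move=> p f _ sf; apply: smooth_atD; exact: vfield_smooth. Qed.
Definition vfieldD (V W : vfield) : vfield := MkVfield (vfieldD_smooth V W).

Lemma vfieldZ_smooth (h : Cinf M) (V : vfield) :
  smooth_section_on setT (fun p => h p *: V p).
Proof.
move=> p f _ sf; apply: smooth_atM; first exact: Cinf_smooth.
exact: vfield_smooth.
Qed.
Definition vfieldZ (h : Cinf M) (V : vfield) : vfield :=
  MkVfield (vfieldZ_smooth h V).

Fact vfieldDA : associative vfieldD.
Proof. by move=> U V W; apply/vfieldP => p; exact: addrA. Qed.
Fact vfieldDC : commutative vfieldD.
Proof. by move=> U V; apply/vfieldP => p; exact: addrC. Qed.
Fact vfieldD0 : left_id vfield0 vfieldD.
Proof. by move=> U; apply/vfieldP => p; exact: add0r. Qed.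
Fact vfieldDN : left_inverse vfield0 vfieldN vfieldD.
Proof. by move=> U; apply/vfieldP => p; exact: addNr. Qed.
HB.instance Definition _ :=
  GRing.isZmodule.Build vfield vfieldDA vfieldDC vfieldD0 vfieldDN.

Fact vfieldZA (a b : Cinf M) (V : vfield) :
  vfieldZ a (vfieldZ b V) = vfieldZ (a * b) V.
Proof. by apply/vfieldP => p; exact: scalerA. Qed.
Fact vfieldZ1 : left_id 1 vfieldZ.
Proof. by move=> V; apply/vfieldP => p; exact: scale1r. Qed.
Fact vfieldZDr : right_distributive vfieldZ +%R.
Proof. by move=> a V W; apply/vfieldP => p; exact: scalerDr. Qed.
Fact vfieldZDl (V : vfield) : {morph vfieldZ^~ V : a b / a + b}.
Proof. by move=> a b; apply/vfieldP => p; exact: scalerDl. Qed.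
HB.instance Definition _ := GRing.Zmodule_isLmodule.Build
  (Cinf M) vfield vfieldZA vfieldZ1 vfieldZDr vfieldZDl.

Definition vact (V : vfield) (f : Cinf M) : Cinf M :=
  mkCinf (fun p => vfield_smooth V I (Cinf_smooth f p)).

Definition bracket_val (V W : vfield) (p : M) (f : M -> R) : R :=
  if `[< smooth_at p f >] then V p (fun q => W q f) - W p (fun q => V q f)
  else 0.

Lemma bracket_derivation V W p : derivation_pred p (bracket_val V W p).
Proof.
apply/asboolP; split=> [f nf|a f g sf sg|f g sf sg]; rewrite /bracket_val.
- by rewrite asboolF.
- rewrite !asboolT//; last by apply: smooth_atD => //; exact: smooth_atZ.
  have lin (X Y : vfield) : X p (fun q => Y q (a *: f + g)) =
      a * X p (fun q => Y q f) + X p (fun q => Y q g).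
    have sYf : smooth_at p (fun q => Y q f) by exact: vfield_smooth.
    have sYg : smooth_at p (fun q => Y q g) by exact: vfield_smooth.
    rewrite -tangent_linear//; apply: tangent_local.
      by apply: vfield_smooth => //; apply: smooth_atD => //; exact: smooth_atZ.
    apply: filterS2 (smooth_at_near sf) (smooth_at_near sg) => q qf qg.
    by rewrite tangent_linear.
  by rewrite !lin; ring.
- rewrite !asboolT//; last exact: smooth_atM.
  have leib (X Y : vfield) : X p (fun q => Y q (f * g)) =
      X p (fun q => Y q f) * g p + Y p f * X p g +
      (X p f * Y p g + f p * X p (fun q => Y q g)).
    have sYf : smooth_at p (fun q => Y q f) by exact: vfield_smooth.
    have sYg : smooth_at p (fun q => Y q g) by exact: vfield_smooth.
    rewrite -tangent_leibniz// -tangent_leibniz// -tangentD; try exact: smooth_atM.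
    apply: tangent_local.
      by apply: vfield_smooth => //; exact: smooth_atM.
    apply: filterS2 (smooth_at_near sf) (smooth_at_near sg) => q qf qg.
    by rewrite tangent_leibniz.
  by rewrite !leib; ring.
Qed.

Definition bracket_at (V W : vfield) (p : M) : tangent p :=
  MkTangent (bracket_derivation V W p).

Lemma bracket_smooth V W : smooth_section_on setT (bracket_at V W).
Proof.
move=> p f _ sf.
have sVW : smooth_at p ((fun q => V q (fun r => W r f)) -
                        (fun q => W q (fun r => V r f))).
  by apply: smooth_atB; do 2!apply: vfield_smooth => //.
apply: smooth_at_local sVW _.
by apply: filterS (smooth_at_near sf) => q sq; rewrite /= /bracket_val asboolT.
Qed.

Definition bracket (V W : vfield) : vfield := MkVfield (bracket_smooth V W).

End VectorFields.
Arguments vfield {R m} M.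

Section Tensors.
Context {R : realType} {m : nat} {M : manifold R m}.
Implicit Types (V W Z : vfield M).

Record one_form := OneForm {
  form_at : forall p : M, {scalar tangent p};
  form_smooth : forall V p, smooth_at p (fun q => form_at q (V q)) }.

Definition form_app (eta : one_form) V : Cinf M := mkCinf (form_smooth eta V).

Record endo := Endo {
  endo_at : forall p : M, {linear tangent p -> tangent p};
  endo_smooth : forall V, smooth_section_on setT (fun p => endo_at p (V p)) }.

Definition endo_app (phi : endo) V : vfield M := MkVfield (endo_smooth phi V).

Record metric := Metric {
  metric_at : forall p : M, tangent p -> tangent p -> R;
  metric_linear : forall p w, scalar (fun v : tangent p => metric_at v w);
  metric_sym : forall p (v w : tangent p), metric_at v w = metric_at w v;
  metric_pos : forall p (v : tangent p), v != 0 -> 0 < metric_at v v;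
  metric_smooth : forall V W p,
    smooth_at p (fun q => metric_at (V q) (W q)) }.

Definition metric_app (g : metric) V W : Cinf M := mkCinf (metric_smooth g V W).

End Tensors.
Arguments one_form {R m} M.
Arguments endo {R m} M.
Arguments metric {R m} M.
Coercion form_app : one_form >-> Funclass.
Coercion endo_app : endo >-> Funclass.
Coercion metric_app : metric >-> Funclass.

Section ContactGeometry.
Context {R : realType} {m : nat} {M : manifold R m}.
Implicit Types (V W X Y Z : vfield M) (eta : one_form M) (xi : vfield M)
  (phi : endo M) (g : metric M).

(* Normalized by [2 d eta (V, W) = V (eta W) - W (eta V) - eta [V, W]]. *)
Definition ext_d eta V W : Cinf M :=
  (2^-1 : R) *: (vact V (eta W) - vact W (eta V) - eta (bracket V W)).

(* [eta /\ (d eta)^n] evaluated on [E_0, ..., E_2n], up to a positive constant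
   depending only on [n] and on the normalization of the wedge product. *)
Definition wedge_contact n eta (E : 'I_n.*2.+1 -> vfield M) : Cinf M :=
  \sum_(s : 'S_n.*2.+1) (-1) ^+ s *
    (eta (E (s ord0)) *
     \prod_(i < n) ext_d eta (E (s (inord i.*2.+1))) (E (s (inord i.*2.+2)))).

Definition contact_form n eta : Prop :=
  forall p : M, exists E : 'I_n.*2.+1 -> vfield M, wedge_contact eta E p != 0.

Definition reeb_field eta xi : Prop :=
  eta xi = 1 /\ forall V, ext_d eta xi V = 0.

Definition contact_metric n phi xi eta g : Prop :=
  [/\ contact_form n eta,
      reeb_field eta xi,
      forall V, g V xi = eta V,
      forall p (v : tangent p), endo_at phi p (endo_at phi p v) =
        - v + form_at eta p v *: xi p &
      forall V W, ext_d eta V W = g V (phi W)].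

Definition nijenhuis phi V W : vfield M :=
  phi (phi (bracket V W)) + bracket (phi V) (phi W)
  - phi (bracket (phi V) W) - phi (bracket V (phi W)).

Definition sasakian n phi xi eta g : Prop :=
  contact_metric n phi xi eta g /\
  forall V W, nijenhuis phi V W + (2%:R * ext_d eta V W) *: xi = 0.

Definition plane_field := forall p : M, set (tangent p).
Implicit Types L Q : plane_field.

Definition sections L : set (vfield M) := [set V | forall p, L p (V p)].

Definition contact_distribution eta : plane_field :=
  fun p => [set v | form_at eta p v = 0].

Definition conjugate_distribution phi L : plane_field :=
  fun p => [set endo_at phi p v | v in L p].

Definition subbundle k L : Prop :=
  forall p : M, exists2 A, open_nbhs p A &
  exists2 X : 'I_k -> forall q : M, tangent q,
    forall i, smooth_section_on A (X i) &
    forall q, A q ->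
      (forall v, L q v <-> exists c : 'I_k -> R, v = \sum_i c i *: X i q) /\
      (forall c : 'I_k -> R, \sum_i c i *: X i q = 0 -> forall i, c i = 0).

(* Complete integrability by foliated charts: [L] is the tangent distribution
   of a foliation with [k]-dimensional leaves, given locally by the equations
   [x_j = const] for [j >= k]. *)
Definition completely_integrable k L : Prop :=
  forall p : M, exists2 c : chart R m M, maximal_atlas c & chart_dom c p /\
    forall q, chart_dom c q -> forall v : tangent q,
      L q v <-> forall j : 'I_m, (k <= j)%N -> v (fun r => fwd c r 0 j) = 0.

Definition legendrian n eta L : Prop :=
  [/\ subbundle n L,
      forall p, L p `<=` @contact_distribution eta p &
      forall X X', sections L X -> sections L X' -> ext_d eta X X' = 0].

Definition flat xi L : Prop :=
  forall X, sections L X -> sections L (bracket xi X).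

Definition flat_legendrian_foliation n eta xi L : Prop :=
  [/\ legendrian n eta L, completely_integrable n L & flat xi L].

Definition connection (D : vfield M -> vfield M -> vfield M) : Prop :=
  [/\ forall (f : Cinf M) V V' W, D (f *: V + V') W = f *: D V W + D V' W,
      forall V W W', D V (W + W') = D V W + D V W' &
      forall (f : Cinf M) V W, D V (f *: W) = vact V f *: W + f *: D V W].

Definition metric_compatible g (D : vfield M -> vfield M -> vfield M) : Prop :=
  forall V W Z, vact V (g W Z) = g (D V W) Z + g W (D V Z).

Definition torsion (D : vfield M -> vfield M -> vfield M) V W : vfield M :=
  D V W - D W V - bracket V W.

Definition levi_civita g (D : vfield M -> vfield M -> vfield M) : Prop :=
  [/\ connection D, metric_compatible g D & forall V W, torsion D V W = 0].

(* [TM = L1 + L2 + R xi] is a direct sum, with projections [P1], [P2] onto the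
   first two summands and [eta (.) xi] onto the last. *)
Definition splitting eta xi L1 L2 (P1 P2 : endo M) : Prop :=
  forall p (v : tangent p),
    [/\ L1 p (endo_at P1 p v), L2 p (endo_at P2 p v),
        v = endo_at P1 p v + endo_at P2 p v + form_at eta p v *: xi p &
        forall a b c, L1 p a -> L2 p b -> v = a + b + c *: xi p ->
          [/\ a = endo_at P1 p v, b = endo_at P2 p v & c = form_at eta p v]].

(* The operator [H] of the definition of the bi-Legendrian connection; it is
   unique since [d eta] is nondegenerate on the contact distribution. *)
Definition bi_legendrian_operator eta
    (H : vfield M -> vfield M -> vfield M) : Prop :=
  forall V W, sections (contact_distribution eta) (H V W) /\
    forall Z, sections (contact_distribution eta) Z ->
      ext_d eta (H V W) Z =
      vact V (ext_d eta W Z) - ext_d eta W (bracket V Z).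

Definition bi_legendrian_connection eta xi L1 L2
    (D : vfield M -> vfield M -> vfield M) : Prop :=
  connection D /\
  exists (P1 P2 : endo M) (H : vfield M -> vfield M -> vfield M),
  [/\ splitting eta xi L1 L2 P1 P2, bi_legendrian_operator eta H &
      [/\ forall W X, sections L1 X ->
            D W X = P1 (H (P1 W) X) + P1 (bracket (P2 W) X)
                    + P1 (bracket (eta W *: xi) X),
          forall W Y, sections L2 Y ->
            D W Y = P2 (H (P2 W) Y) + P2 (bracket (P1 W) Y)
                    + P2 (bracket (eta W *: xi) Y) &
          forall W (f : Cinf M), D W (f *: xi) = vact W f *: xi]].

End ContactGeometry.
Arguments plane_field {R m} M.

(* Main.v *)
Require Import Defs.
From HB Require Import structures.
From mathcomp Require Import all_boot all_order all_algebra all_fingroup.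
From mathcomp Require Import ring.
From mathcomp Require Import all_classical all_reals all_analysis.
Set Implicit Arguments.
Unset Strict Implicit.
Unset Printing Implicit Defensive.
Import Order.TTheory GRing.Theory Num.Theory numFieldNormedType.Exports.
Local Open Scope classical_set_scope.
Local Open Scope ring_scope.

(** The idea is to compute the torsion of the bi-Legendrian connection and to
    correct it by an explicit tensor without destroying metricity.

    The heart is the identity [T = 2 d eta (x) xi] ([torsion_bi_legendrian]).
    Since the torsion and [d eta] are both tensors, it suffices to test it on
    sections of [L], sections of [Q = phi L], and [xi].  On two sections of the
    same leaf bundle the torsion lies in that bundle, because the bundle is
    involutive, and its pairing with the other bundle through [d eta] is an
    instance of [d (d eta) = 0]; nondegeneracy of [d eta] on the contact
    distribution then gives [T = 0] ([torsion_leaf]).  On one section of each,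
    only the Reeb component of the bracket survives ([torsion_transverse]).
    Against [xi] the torsion measures the failure of flatness
    ([torsion_reeb]).  Flatness of [L] is given; that of [Q] follows because on
    a Sasakian manifold the Reeb flow preserves [phi]
    ([sasakian_lie_phi], [conjugate_flat]).

    Now let [C (V, W) = d eta (V, W) xi + eta (W) phi V + eta (V) phi W].  The
    last two terms together are symmetric in [V] and [W] and the first is half
    the torsion, so [nabla - C] is torsion free.  Each [C (V, .)] is skew for
    [g], as [phi] is, so [nabla - C] is still metric.  By uniqueness it is the
    Levi-Civita connection ([levi_civita_contact]), that is [S = C], and the
    asserted formulas are special values of [C]; on [L] and on [Q] it vanishes
    because both are isotropic for [d eta]. *)

(** * Algebra of functions, vector fields and tensors *)

Section Calculus.
Context {R : realType} {m : nat} {M : manifold R m}.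
Implicit Types (U V W X Y Z : vfield M) (f h : Cinf M) (eta : one_form M)
  (phi : endo M) (g : metric M).

Lemma CinfP f h : (forall p, f p = h p) -> f = h.
Proof. by move=> e; apply/val_inj/funext. Qed.

Lemma tangent0 (p : M) (v : tangent p) : v (cst 0) = 0.
Proof.
have s0 : smooth_at p (cst 0) by exact: smooth_at_cst.
have e : cst 0 = cst 0 * cst 0 :> (M -> R) by apply/funext => q /=; rewrite mulr0.
by rewrite e tangent_leibniz//= mulr0 mul0r addr0.
Qed.

Lemma tangentB (p : M) (v : tangent p) (f h : M -> R) :
  smooth_at p f -> smooth_at p h -> v (f - h) = v f - v h.
Proof.
move=> sf sh; rewrite -scaleN1r addrC tangent_linear//.
by rewrite mulN1r addrC.
Qed.

(** The linear structures below make the generic additivity and scaling lemmas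
    available for derivations, one-forms, endomorphisms and the metric, with
    functions as scalars where the operation is tensorial. *)
Fact vact_linear V : linear (vact V : Cinf M -> Cinf M).
Proof.
move=> a f h; apply/CinfP => p /=.
by rewrite tangent_linear//; exact: Cinf_smooth.
Qed.
HB.instance Definition _ V :=
  GRing.isLinear.Build R (Cinf M) (Cinf M) *:%R (vact V) (vact_linear V).

Lemma vactB V f h : vact V (f - h) = vact V f - vact V h.
Proof. exact: raddfB. Qed.

Lemma vactM V f h : vact V (f * h) = vact V f * h + f * vact V h.
Proof.
by apply/CinfP => p /=; rewrite tangent_leibniz//; exact: Cinf_smooth.
Qed.

Lemma vact1 V : vact V 1 = 0.
Proof.
have := vactM V 1 1; rewrite !mulr1 mul1r => /eqP.
by rewrite -[X in X == _]addr0 (inj_eq (addrI _)) eq_sym => /eqP.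
Qed.

Lemma vact0l f : vact (0 : vfield M) f = 0.
Proof. exact: CinfP. Qed.

Fact form_app_linear eta : scalar (form_app eta : vfield M -> Cinf M).
Proof. by move=> h V W; apply/CinfP => p /=; rewrite linearP. Qed.
HB.instance Definition _ eta :=
  GRing.isLinear.Build (Cinf M) (vfield M) (Cinf M) *%R (form_app eta)
    (form_app_linear eta).

Fact endo_app_linear phi : linear (endo_app phi : vfield M -> vfield M).
Proof. by move=> h V W; apply/vfieldP => p /=; rewrite linearP. Qed.
HB.instance Definition _ phi :=
  GRing.isLinear.Build (Cinf M) (vfield M) (vfield M) *:%R (endo_app phi)
    (endo_app_linear phi).

Lemma metricC g V W : g V W = g W V.
Proof. by apply/CinfP => p /=; rewrite Defs.metric_sym. Qed.

Fact metric_app_linear g V : scalar (metric_app g V : vfield M -> Cinf M).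
Proof.
by move=> h W Z; rewrite ![metric_app g V _]metricC; apply/CinfP => p /=;
   rewrite metric_linear.
Qed.
HB.instance Definition _ g V :=
  GRing.isLinear.Build (Cinf M) (vfield M) (Cinf M) *%R (metric_app g V)
    (metric_app_linear g V).

Lemma metricDl g V W Z : g (V + W) Z = g V Z + g W Z.
Proof. by rewrite ![metric_app g _ Z]metricC linearD. Qed.

Lemma metricNl g V Z : g (- V) Z = - g V Z.
Proof. by rewrite ![metric_app g _ Z]metricC linearN. Qed.

Lemma metricZl g h V Z : g (h *: V) Z = h * g V Z.
Proof. by rewrite ![metric_app g _ Z]metricC linearZ. Qed.

Lemma metric_eq0 g V : g V V = 0 -> V = 0.
Proof.
move=> gV; apply/vfieldP => p; apply/eqP/negPn/negP => /(metric_pos g).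
by rewrite (_ : metric_at _ _ _ = g V V p)// gV ltxx.
Qed.

Lemma bracketE V W p (f : M -> R) : smooth_at p f ->
  bracket V W p f = V p (fun q => W q f) - W p (fun q => V q f).
Proof. by move=> sf; rewrite /= /bracket_val asboolT. Qed.

Lemma vfield_eq V W :
  (forall p (f : M -> R), smooth_at p f -> V p f = W p f) -> V = W.
Proof. by move=> e; apply/vfieldP => p; apply: tangentP => f; exact: e. Qed.

(** Evaluating a vector field at a point on a germ is compatible with the module
    operations; an identity between vector fields thereby becomes an identity
    in the base field that [ring] decides. *)
Fact vfieldDE V W p (f : M -> R) : (V + W) p f = V p f + W p f.
Proof. by []. Qed.
Fact vfieldNE V p (f : M -> R) : (- V) p f = - V p f.
Proof. by []. Qed.
Fact vfieldZE h V p (f : M -> R) : (h *: V) p f = h p * V p f.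
Proof. by []. Qed.
Fact vfield0E p (f : M -> R) : (0 : vfield M) p f = 0.
Proof. by []. Qed.
Definition vfieldE := (vfieldDE, vfieldNE, vfieldZE, vfield0E).

Lemma bracketC V W : bracket V W = - bracket W V.
Proof. by apply: vfield_eq => p f sf; rewrite vfieldE !bracketE// opprB. Qed.

Lemma bracketvv V : bracket V V = 0.
Proof. by apply: vfield_eq => p f sf; rewrite vfieldE bracketE// subrr. Qed.

Lemma bracketDl V V' W : bracket (V + V') W = bracket V W + bracket V' W.
Proof.
apply: vfield_eq => p f sf; rewrite vfieldE !bracketE// vfieldE.
have -> : W p (fun q => (V + V') q f) =
    W p (fun q => V q f) + W p (fun q => V' q f).
  by rewrite -tangentD//; exact: vfield_smooth.
by ring.
Qed.

Lemma bracketZl h V W :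
  bracket (h *: V) W = h *: bracket V W - vact W h *: V.
Proof.
apply: vfield_eq => p f sf; rewrite !vfieldE !bracketE// vfieldE.
have -> : W p (fun q => (h *: V) q f) =
    W p h * V p f + h p * W p (fun q => V q f).
  rewrite -tangent_leibniz//; first exact: Cinf_smooth.
  exact: vfield_smooth.
by rewrite (_ : vact W h p = W p h)//; ring.
Qed.

Lemma bracket0l W : bracket 0 W = 0.
Proof. by apply: (addIr (bracket 0 W)); rewrite -bracketDl !add0r. Qed.

Lemma vact_bracket V W f :
  vact (bracket V W) f = vact V (vact W f) - vact W (vact V f).
Proof. by apply/CinfP => p; exact: bracketE (Cinf_smooth f p). Qed.

Lemma bracket_jacobi U V W :
  bracket (bracket U V) W + bracket (bracket V W) U + bracket (bracket W U) V
  = 0.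
Proof.
apply: vfield_eq => p f sf.
have sX X q (k : M -> R) : smooth_at q k -> smooth_at q (fun r => X r k).
  by move=> sk; exact: vfield_smooth.
have E X Y Z : bracket (bracket X Y) Z p f =
    X p (fun q => Y q (fun r => Z r f)) - Y p (fun q => X q (fun r => Z r f))
    - (Z p (fun q => X q (fun r => Y r f))
       - Z p (fun q => Y q (fun r => X r f))).
  rewrite bracketE// bracketE//; last exact: sX.
  congr (_ - _); rewrite -tangentB; try by apply: (sX); apply: sX.
  apply: tangent_local; first exact: sX.
  by apply: filterS (smooth_at_near sf) => q sq; rewrite bracketE.
by rewrite !vfieldE !E; ring.
Qed.

Lemma ext_dC eta V W : ext_d eta V W = - ext_d eta W V.
Proof.
by rewrite /ext_d [bracket V W]bracketC linearN -scalerN; congr (_ *: _); ring.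
Qed.

Lemma ext_d_double eta V W :
  ext_d eta V W *+ 2 = vact V (eta W) - vact W (eta V) - eta (bracket V W).
Proof.
by rewrite /ext_d scalerMnl -mulr_natr mulVf ?pnatr_eq0// scale1r.
Qed.

(** The Cartan formula for [d (d eta) = 0]: second derivatives of the values of
    [eta] cancel in pairs, and the triple brackets cancel by the Jacobi
    identity. *)
Lemma ext_d_closed eta U V W :
  vact U (ext_d eta V W) + vact V (ext_d eta W U) + vact W (ext_d eta U V)
  - ext_d eta (bracket U V) W - ext_d eta (bracket V W) U
  - ext_d eta (bracket W U) V = 0.
Proof.
have J : eta (bracket (bracket U V) W) =
    - eta (bracket (bracket V W) U) - eta (bracket (bracket W U) V).
  have /(congr1 eta) := bracket_jacobi U V W.
  rewrite !linearD linear0 => /eqP; rewrite -addrA addr_eq0 => /eqP ->.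
  by rewrite opprD.
rewrite /ext_d !linearZ /= -!scalerDr !vactB !vact_bracket J.
by rewrite [X in _ *: X](_ : _ = 0) ?scaler0//; ring.
Qed.

(** The easy half of the Frobenius theorem: sections of [L] annihilate the
    transverse coordinates of a foliated chart, and then so does their
    commutator. *)
Lemma completely_integrable_involutive k (L : plane_field M) V W :
  completely_integrable k L -> sections L V -> sections L W ->
  sections L (bracket V W).
Proof.
move=> ci sV sW p; have [c [chc _] [cp Lc]] := ci p.
have [oc _ _ _ _] := chc.
apply/Lc => // j kj; rewrite /= /bracket_val; case: asboolP => // _.
have Z X Y : sections L Y -> X p (fun q => Y q (fun r => fwd c r 0 j)) = 0.
  move=> sY; rewrite -(tangent0 (X p)); apply/esym/tangent_local.
    exact: smooth_at_cst.
  apply: filterS (open_nbhs_nbhs (conj oc cp)) => q cq /=.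
  by apply/esym; move: j kj; apply/Lc.
by rewrite !Z// subrr.
Qed.

Lemma torsionC D V W : torsion D V W = - torsion D W V.
Proof.
rewrite /torsion [bracket V W]bracketC.
by apply: vfield_eq => p f _; rewrite !vfieldE; ring.
Qed.

(** Tensoriality: the derivative of [h] produced by the Leibniz rule of the
    connection is the one produced by the bracket. *)
Lemma torsionP D h V V' W : connection D ->
  torsion D (h *: V + V') W = h *: torsion D V W + torsion D V' W.
Proof.
case=> D1 D2 D3; rewrite /torsion D1 D2 D3 bracketDl bracketZl.
by apply: vfield_eq => p f _; rewrite !vfieldE; ring.
Qed.

(** The difference [A] of two such connections is symmetric in its arguments
    because the torsions agree, while [A V] is skew for [g].  A trilinear form
    symmetric in one pair of slots and skew in another is zero. *)
Lemma levi_civita_unique g D D' :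
  metric_compatible g D -> metric_compatible g D' ->
  (forall V W, torsion D V W = torsion D' V W) -> D = D'.
Proof.
move=> gD gD' tD; pose A V W := D V W - D' V W.
have As V W : A V W = A W V.
  apply: vfield_eq => p f _; have /(congr1 (fun X : vfield M => X p f)) := tD V W.
  rewrite /torsion/A !vfieldE => e; apply/eqP; rewrite -subr_eq0.
  by move/eqP: e; rewrite -subr_eq0 => /eqP <-; apply/eqP; ring.
have Aa V W Z : g (A V W) Z = - g (A V Z) W.
  have := gD V W Z; rewrite gD' /A !metricDl !metricNl [g W _]metricC.
  rewrite [g W (D V Z)]metricC => /eqP; rewrite -subr_eq0 => /eqP e.
  by apply/eqP; rewrite -subr_eq0 -oppr_eq0 -e; apply/eqP; ring.
have A0 V W Z : g (A V W) Z = 0.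
  have e : g (A V W) Z *+ 2 = 0.
    apply/eqP; rewrite mulr2n addr_eq0; apply/eqP.
    by rewrite [LHS]Aa [A V Z]As (Aa Z) opprK [A Z W]As [LHS]Aa [A W V]As.
  apply/CinfP => p; have /eqP := congr1 (fun f : Cinf M => f p) e.
  by rewrite (_ : _ p = g (A V W) Z p *+ 2)// mulrn_eq0 => /eqP.
apply/funext => V; apply/funext => W; apply/eqP; rewrite -subr_eq0; apply/eqP.
exact: metric_eq0 (A0 V W _).
Qed.

End Calculus.

(** * Contact metric and Sasakian structures *)

Section ContactMetric.
Context {R : realType} {m n : nat} {M : manifold R m}.
Context {phi : endo M} {xi : vfield M} {eta : one_form M} {g : metric M}.
Implicit Types (V W X Y Z : vfield M) (L : plane_field M).

Lemma eta_bracket_reeb V : reeb_field eta xi ->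
  eta (bracket xi V) = vact xi (eta V).
Proof.
case=> exi dxi; have := ext_d_double eta xi V; rewrite dxi mul0rn exi vact1.
by rewrite subr0 => /esym/eqP; rewrite subr_eq0 => /eqP.
Qed.

Section Structure.
Hypothesis cm : contact_metric n phi xi eta g.

Lemma contact_phi2 V : phi (phi V) = - V + eta V *: xi.
Proof. by have [_ _ _ E _] := cm; apply/vfieldP => p; exact: E. Qed.

Lemma contact_metric_skew V W : g (phi V) W = - g V (phi W).
Proof. by have [_ _ _ _ E] := cm; rewrite metricC -!E ext_dC. Qed.

Lemma contact_phi_reeb : phi xi = 0.
Proof.
have [_ [_ dxi] _ _ E] := cm; apply: metric_eq0 (g) _ _.
by rewrite -E ext_dC dxi oppr0.
Qed.

Lemma contact_eta_phi V : eta (phi V) = 0.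
Proof.
have [_ _ E _ _] := cm.
by rewrite -E contact_metric_skew contact_phi_reeb linear0 oppr0.
Qed.

Lemma ext_dDr V W W' : ext_d eta V (W + W') = ext_d eta V W + ext_d eta V W'.
Proof. by have [_ _ _ _ E] := cm; rewrite !E !linearD. Qed.

Lemma ext_dZr (h : Cinf M) V W : ext_d eta V (h *: W) = h * ext_d eta V W.
Proof. by have [_ _ _ _ E] := cm; rewrite !E !linearZ. Qed.

Lemma ext_d0r V : ext_d eta V 0 = 0.
Proof. by have [_ _ _ _ E] := cm; rewrite E !linear0. Qed.

Lemma ext_dDl V V' W : ext_d eta (V + V') W = ext_d eta V W + ext_d eta V' W.
Proof. by rewrite ext_dC ext_dDr opprD -!ext_dC. Qed.

Lemma ext_dZl (h : Cinf M) V W : ext_d eta (h *: V) W = h * ext_d eta V W.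
Proof. by rewrite ext_dC ext_dZr -mulrN -ext_dC. Qed.

Lemma ext_dNl V W : ext_d eta (- V) W = - ext_d eta V W.
Proof. by rewrite -[- V]scaleN1r ext_dZl mulN1r. Qed.

(** The test field [phi V] detects [V], since [d eta (V, phi V) = - g (V, V)]
    when [eta V = 0]. *)
Lemma ext_d_nondegenerate V : eta V = 0 ->
  (forall Z, eta Z = 0 -> ext_d eta V Z = 0) -> V = 0.
Proof.
have [_ _ _ _ E] := cm => eV dV; apply: metric_eq0 (g) _ _.
have := dV _ (contact_eta_phi V); rewrite E contact_phi2 eV scale0r addr0.
by rewrite linearN => /eqP; rewrite oppr_eq0 => /eqP.
Qed.

Lemma ext_d_phi V W : eta W = 0 -> ext_d eta (phi V) (phi W) = ext_d eta V W.
Proof.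
have [_ _ _ _ E] := cm => eW.
by rewrite !E contact_phi2 eW scale0r addr0 contact_metric_skew !linearN opprK.
Qed.

End Structure.

(** Evaluated on [xi] and [V], the Sasakian condition says that the difference
    of the two sides lies in the kernel of [phi], the line spanned by [xi];
    its [xi]-component vanishes since the Reeb flow preserves [eta]. *)
Lemma sasakian_lie_phi V : sasakian n phi xi eta g ->
  bracket xi (phi V) = phi (bracket xi V).
Proof.
case=> cm nij; have [_ rf _ _ _] := cm; have [_ dxi] := rf.
pose U := phi (bracket xi V) - bracket xi (phi V).
have phiU : phi U = 0.
  have := nij xi V; rewrite /nijenhuis dxi mulr0 scale0r addr0.
  by rewrite (contact_phi_reeb cm) !bracket0l linear0 addr0 subr0 -linearB.
have etaU : eta U = 0.
  rewrite linearB /= (contact_eta_phi cm) sub0r eta_bracket_reeb//.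
  by rewrite (contact_eta_phi cm) linear0 oppr0.
have /esym/eqP := contact_phi2 cm U.
rewrite phiU linear0 etaU scale0r addr0 oppr_eq0 subr_eq0 => /eqP.
exact: esym.
Qed.

Lemma eta_sections V :
  sections (contact_distribution eta) V <-> eta V = 0.
Proof.
split=> [sV|e p]; first by apply: CinfP => p; exact: sV.
exact: (congr1 (fun f : Cinf M => f p) e).
Qed.

(** The preimage can be taken smooth, namely [- phi Y], as [phi] squares to
    [- 1] on the contact distribution. *)
Lemma conjugate_sections L Y : contact_metric n phi xi eta g ->
  (forall p, L p `<=` @contact_distribution _ _ _ eta p) ->
  sections (conjugate_distribution phi L) Y ->
  exists X, [/\ sections L X, eta X = 0 & Y = phi X].
Proof.
move=> cm LD sY; have [_ _ _ phi2 _] := cm.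
have sX : sections L (- phi Y).
  move=> p; have [v Lv e] := sY p.
  rewrite (_ : (- phi Y) p = v)//= -e phi2 (LD _ _ Lv).
  by rewrite scale0r addr0 opprK.
have eX : eta (- phi Y) = 0 by rewrite linearN /= (contact_eta_phi cm) oppr0.
exists (- phi Y); split=> //.
apply/vfieldP => p; have [v Lv e] := sY p.
rewrite linearN.
rewrite (_ : _ p = - endo_at phi p (endo_at phi p (Y p)))//.
by rewrite -e (phi2 p v) (LD _ _ Lv) scale0r addr0 linearN opprK.
Qed.

End ContactMetric.

(** * The bi-Legendrian connection *)

Section Splitting.
Context {R : realType} {m : nat} {M : manifold R m}.
Context {xi : vfield M} {eta : one_form M} {L1 L2 : plane_field M}
  {P1 P2 : endo M}.
Implicit Types (V W X Y Z : vfield M).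

Lemma splitting_sym :
  splitting eta xi L1 L2 P1 P2 -> splitting eta xi L2 L1 P2 P1.
Proof.
move=> spl p v; have [L1v L2v e u] := spl p v; split=> //.
  by rewrite [endo_at P2 p v + _]addrC.
by move=> a b c La Lb; rewrite [a + b]addrC => /(u b a c Lb La)[-> -> ->].
Qed.

Hypothesis spl : splitting eta xi L1 L2 P1 P2.

Lemma splittingE V : V = P1 V + P2 V + eta V *: xi.
Proof. by apply/vfieldP => p; have [] := spl (V p). Qed.

Lemma splitting_sections V : sections L1 (P1 V).
Proof. by move=> p; have [] := spl (V p). Qed.

(** Uniqueness of the decomposition makes the sections of a summand the fixed
    fields of its projection; so they form a linear space. *)
Lemma splitting_sectionsE X :
  sections L1 X <-> [/\ P1 X = X, P2 X = 0 & eta X = 0].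
Proof.
split=> [sX|[<- _ _]]; last exact: splitting_sections.
suff e p : [/\ X p = endo_at P1 p (X p), 0 = endo_at P2 p (X p) &
    0 = form_at eta p (X p)].
  split; [apply/vfieldP => p|apply/vfieldP => p|apply/CinfP => p];
    by have [] := e p.
have [_ _ _ u] := spl (X p); apply: u => //.
- by have [_ + _ _] := spl (0 : tangent p); rewrite linear0.
- by rewrite scale0r !addr0.
Qed.

End Splitting.

Definition isotropic (R : realType) (m : nat) (M : manifold R m)
    (eta : one_form M) (L : plane_field M) : Prop :=
  forall X X', sections L X -> sections L X' -> ext_d eta X X' = 0.

Definition involutive (R : realType) (m : nat) (M : manifold R m)
    (L : plane_field M) : Prop :=
  forall X X', sections L X -> sections L X' -> sections L (bracket X X').

Section BiLegendrian.
Context {R : realType} {m n : nat} {M : manifold R m}.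
Context {phi : endo M} {xi : vfield M} {eta : one_form M} {g : metric M}.
Implicit Types (V W X Y Z : vfield M) (L : plane_field M)
  (D : vfield M -> vfield M -> vfield M).
Hypothesis cm : contact_metric n phi xi eta g.

(** The two distributions play the same role, so that each of the torsion
    formulas below needs to be proved for one ordering only. *)
Lemma bi_legendrian_sym L1 L2 D :
  bi_legendrian_connection eta xi L1 L2 D ->
  bi_legendrian_connection eta xi L2 L1 D.
Proof.
case=> cD [P1 [P2 [H [spl Hop [D1 D2 D3]]]]]; split=> //.
by exists P2, P1, H; split=> //; exact: splitting_sym.
Qed.

Lemma bi_legendrian_operator0l H W : bi_legendrian_operator eta H ->
  H 0 W = 0.
Proof.
move=> Hop; have [/eta_sections eH dH] := Hop 0 W.
apply: (ext_d_nondegenerate cm) => // Z /eta_sections/dH ->.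
by rewrite bracket0l (ext_d0r cm) vact0l subr0.
Qed.

(** The torsion lies in [L1], hence pairs to zero with [L1]; against a section [Y]
    of [L2] the definition of [H] turns [d eta (T (X, X'), Y)] into the value
    of [d (d eta)] on [X], [X'], [Y].  So [d eta (T (X, X'), .)] vanishes on
    the contact distribution. *)
Lemma torsion_leaf L1 L2 D X X' : bi_legendrian_connection eta xi L1 L2 D ->
  isotropic eta L1 -> isotropic eta L2 -> involutive L1 ->
  sections L1 X -> sections L1 X' -> torsion D X X' = 0.
Proof.
case=> cD [P1 [P2 [H [spl Hop [D1 _ _]]]]] iso1 iso2 inv1 sX sX'.
have spl' := splitting_sym spl.
have DE U V : sections L1 U -> sections L1 V -> D U V = P1 (H U V).
  move=> sU sV; have [P1U P2U eU] := (splitting_sectionsE spl U).1 sU.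
  by rewrite D1// P1U P2U eU scale0r !bracket0l linear0 !addr0.
have dP U V Y : sections L2 Y -> sections L1 U -> sections L1 V ->
    ext_d eta (P1 (H U V)) Y = vact U (ext_d eta V Y)
      - ext_d eta V (bracket U Y).
  move=> sY sU sV; have [/eta_sections eH dH] := Hop U V.
  have [_ _ eY] := (splitting_sectionsE spl' Y).1 sY.
  rewrite -dH; last exact/eta_sections.
  rewrite [in RHS](splittingE spl (H U V)) eH scale0r addr0 (ext_dDl cm).
  by rewrite [X in _ + X](iso2 _ _ (splitting_sections spl' _) sY) addr0.
have sT : sections L1 (torsion D X X').
  rewrite /torsion !DE//; apply/(splitting_sectionsE spl).
  have sH U V : sections L1 (P1 (H U V)) by exact: splitting_sections.
  have [e1 e2 e3] := (splitting_sectionsE spl _).1 (inv1 _ _ sX sX').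
  have [a1 a2 a3] := (splitting_sectionsE spl _).1 (sH X X').
  have [b1 b2 b3] := (splitting_sectionsE spl _).1 (sH X' X).
  rewrite !linearB /=.
  by split; [rewrite a1 b1 e1|rewrite a2 b2 e2 !subr0|rewrite a3 b3 e3 !subr0].
have [_ _ eT] := (splitting_sectionsE spl _).1 sT.
apply: (ext_d_nondegenerate cm) => // Z eZ.
rewrite (splittingE spl Z) eZ scale0r addr0 (ext_dDr cm).
rewrite (iso1 _ _ sT (splitting_sections spl Z)) add0r.
have sY : sections L2 (P2 Z) by exact: splitting_sections spl' _.
move: (P2 Z) sY => Y sY.
rewrite /torsion !DE// !(ext_dDl cm) !(ext_dNl cm) !dP//.
have := ext_d_closed eta X X' Y.
(* The term [Y (d eta (X, X'))] drops out of the closedness identity. *)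
rewrite (iso1 X X')// linear0 addr0 => <-.
rewrite (ext_dC eta X (bracket X' Y)) (ext_dC eta X' (bracket X Y)).
rewrite (ext_dC eta Y X) [bracket Y X]bracketC linearN /= (ext_dNl cm).
by ring.
Qed.

(** The covariant derivatives remove exactly the [L1] and [L2] components of
    the bracket, and [eta [X, Y] = - 2 d eta (X, Y)]. *)
Lemma torsion_transverse L1 L2 D X Y :
  bi_legendrian_connection eta xi L1 L2 D ->
  sections L1 X -> sections L2 Y ->
  torsion D X Y = (ext_d eta X Y *+ 2) *: xi.
Proof.
case=> cD [P1 [P2 [H [spl Hop [D1 D2 _]]]]] sX sY.
have spl' := splitting_sym spl.
have [P1X P2X eX] := (splitting_sectionsE spl _).1 sX.
have [P2Y P1Y eY] := (splitting_sectionsE spl' _).1 sY.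
rewrite /torsion (D2 X Y)// (D1 Y X)// P1X P2X eX P1Y P2Y eY.
rewrite !(bi_legendrian_operator0l _ Hop) !scale0r !bracket0l !linear0 !add0r.
rewrite !addr0 ext_d_double eX eY !linear0 !add0r scaleNr.
rewrite [X in _ - X = _](splittingE spl (bracket X Y)).
rewrite [bracket Y X]bracketC linearN /= opprK.
by rewrite [P1 (bracket X Y) + P2 _]addrC opprD addrA addrN add0r.
Qed.

(** Here [D X xi = 0], and [D xi X] is the [L1] component of [[xi, X]], which is
    the whole bracket by flatness. *)
Lemma torsion_reeb L1 L2 D X : bi_legendrian_connection eta xi L1 L2 D ->
  flat xi L1 -> sections L1 X -> torsion D X xi = 0.
Proof.
case=> cD [P1 [P2 [H [spl Hop [D1 D2 D3]]]]] fl sX.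
have [_ [exi _] _ _ _] := cm.
have spl' := splitting_sym spl.
have s0 : sections L1 0 by apply/(splitting_sectionsE spl); rewrite !linear0.
have s0' : sections L2 0 by apply/(splitting_sectionsE spl'); rewrite !linear0.
have [P1xi P2xi] : P1 xi = 0 /\ P2 xi = 0.
  suff e p : 0 = endo_at P1 p (xi p) /\ 0 = endo_at P2 p (xi p).
    by split; apply/vfieldP => p; have [] := e p.
  have [_ _ _ u] := spl p (xi p).
  by have [|] := u 0 0 1 (s0 p) (s0' p); first by rewrite scale1r !add0r.
have [Pb _ _] := (splitting_sectionsE spl _).1 (fl _ sX).
have Dxi : D X xi = 0.
  by have := D3 X 1; rewrite scale1r vact1 scale0r.
rewrite /torsion Dxi D1// P1xi P2xi (bi_legendrian_operator0l _ Hop).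
rewrite bracket0l !linear0 !add0r exi scale1r Pb [bracket X xi]bracketC.
by rewrite opprK addNr.
Qed.

(** Both sides are alternating tensors, and the three summands of the splitting
    span all vector fields, so the previous three lemmas cover every case. *)
Lemma torsion_bi_legendrian L1 L2 D V W :
  bi_legendrian_connection eta xi L1 L2 D ->
  isotropic eta L1 -> isotropic eta L2 -> involutive L1 -> involutive L2 ->
  flat xi L1 -> flat xi L2 ->
  torsion D V W = (ext_d eta V W *+ 2) *: xi.
Proof.
move=> bi iso1 iso2 inv1 inv2 fl1 fl2; have bi' := bi_legendrian_sym bi.
have [cD [P1 [P2 [_ [spl _ _]]]]] := bi; have spl' := splitting_sym spl.
have [_ [_ dxi] _ _ _] := cm.
pose B U Z := torsion D U Z - (ext_d eta U Z *+ 2) *: xi.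
have BC U Z : B U Z = - B Z U.
  by rewrite /B (torsionC D U) (ext_dC eta U) mulNrn scaleNr [RHS]opprD.
have Blin (h : Cinf M) U U' Z : B (h *: U + U') Z = h *: B U Z + B U' Z.
  rewrite /B torsionP// (ext_dDl cm) (ext_dZl cm).
  move: (torsion D U Z) (torsion D U' Z) => t t'; rewrite scalerBr scalerA.
  by rewrite mulrnDl scalerDl opprD mulrnAr addrACA.
(* By linearity in the first slot; the second slot is reached through [BC]. *)
have split0 Z : (forall X, sections L1 X -> B X Z = 0) ->
    (forall Y, sections L2 Y -> B Y Z = 0) -> B xi Z = 0 ->
    forall U, B U Z = 0.
  move=> B1 B2 B3 U; rewrite (splittingE spl U) addrC Blin B3 scaler0 add0r.
  rewrite -[P1 U]scale1r Blin scale1r B1 ?B2 ?addr0//.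
    exact: splitting_sections spl' _.
  exact: splitting_sections.
suff B0 : B V W = 0 by apply/eqP; rewrite -subr_eq0; apply/eqP.
have Bxi U : B U xi = 0.
  apply: split0 => [X sX|Y sY|].
  - by rewrite /B (torsion_reeb bi)// ext_dC dxi oppr0 mul0rn scale0r subrr.
  - by rewrite /B (torsion_reeb bi')// ext_dC dxi oppr0 mul0rn scale0r subrr.
  - rewrite /B dxi mul0rn scale0r subr0 /torsion subrr sub0r.
    by rewrite bracketvv oppr0.
have BL1 X : sections L1 X -> forall U, B U X = 0.
  move=> sX; apply: split0 => [X' sX'|Y sY|]; last by rewrite BC Bxi oppr0.
    by rewrite /B (torsion_leaf bi)// iso1// mul0rn scale0r subrr.
  by rewrite /B (torsion_transverse bi')// subrr.
have BL2 Y : sections L2 Y -> forall U, B U Y = 0.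
  move=> sY; apply: split0 => [X sX|Y' sY'|]; last by rewrite BC Bxi oppr0.
    by rewrite /B (torsion_transverse bi)// subrr.
  by rewrite /B (torsion_leaf bi')// iso2// mul0rn scale0r subrr.
apply: split0 => [X sX|Y sY|]; rewrite BC.
- by rewrite BL1// oppr0.
- by rewrite BL2// oppr0.
- by rewrite Bxi oppr0.
Qed.

End BiLegendrian.

(** * The conjugate distribution and the Levi-Civita connection *)

Section Conjugate.
Context {R : realType} {m n : nat} {M : manifold R m}.
Context {phi : endo M} {xi : vfield M} {eta : one_form M} {g : metric M}.

Lemma conjugate_isotropic (L : plane_field M) :
  contact_metric n phi xi eta g ->
  (forall p, L p `<=` @contact_distribution _ _ _ eta p) ->
  isotropic eta L -> isotropic eta (conjugate_distribution phi L).
Proof.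
move=> cm LD iso Y Y' /(conjugate_sections cm LD)[X [sX _ ->]].
move=> /(conjugate_sections cm LD)[X' [sX' eX' ->]].
by rewrite (ext_d_phi cm)// iso.
Qed.

(** As [phi] commutes with the Reeb derivative, [[xi, phi X] = phi [xi, X]]. *)
Lemma conjugate_flat (L : plane_field M) : sasakian n phi xi eta g ->
  (forall p, L p `<=` @contact_distribution _ _ _ eta p) ->
  flat xi L -> flat xi (conjugate_distribution phi L).
Proof.
move=> sas LD fl Y /(conjugate_sections sas.1 LD)[X [sX _ ->]].
rewrite (sasakian_lie_phi X sas) => p.
by exists (bracket xi X p) => //; exact: fl.
Qed.

End Conjugate.

(** A metric connection with torsion [2 d eta (x) xi] differs from the
    Levi-Civita connection by a tensor [C] whose antisymmetrization is that torsion
    and whose partial evaluations [C (U, .)] are skew for [g]; subtracting [C] leaves a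
    connection to which uniqueness applies. *)
Lemma levi_civita_contact (R : realType) (m n : nat) (M : manifold R m)
    (phi : endo M) (xi : vfield M) (eta : one_form M) (g : metric M)
    (D hD : vfield M -> vfield M -> vfield M) V W :
  contact_metric n phi xi eta g -> metric_compatible g D ->
  (forall U U', torsion D U U' = (ext_d eta U U' *+ 2) *: xi) ->
  levi_civita g hD ->
  D V W - hD V W = ext_d eta V W *: xi + (eta W *: phi V + eta V *: phi W).
Proof.
move=> cm gD tD [_ ghD thD]; have [_ _ gxi _ E] := cm.
pose C U Z := ext_d eta U Z *: xi + (eta Z *: phi U + eta U *: phi Z).
have gxil Z : g xi Z = eta Z by rewrite metricC gxi.
suff <- : (fun U Z => D U Z - C U Z) = hD by rewrite opprB addrC subrK.
apply: (levi_civita_unique (g := g)) => // [U Z Z'|U Z].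
  have CA : g (C U Z) Z' + g (C U Z') Z = 0.
    rewrite /C !metricDl !metricZl !gxil !(contact_metric_skew cm) !E.
    by rewrite [g Z' _]metricC (contact_metric_skew cm); ring.
  rewrite gD [g Z (D _ _ - _)]metricC !metricDl !metricNl.
  rewrite [g Z (D _ _)]metricC; apply/eqP; rewrite -subr_eq0; apply/eqP.
  by rewrite -[RHS]CA; ring.
rewrite thD; have := tD U Z; rewrite /torsion => tUZ.
have -> : C U Z = C Z U + (ext_d eta U Z *+ 2) *: xi.
  rewrite /C (ext_dC eta Z U) mulr2n scaleNr scalerDl.
  move: (_ *: xi) (eta Z *: _) (eta U *: _) => a b c.
  by rewrite [RHS]addrC addrACA subrr add0r [b + c]addrC.
rewrite -tUZ; move: (C Z U) (D U Z) (D Z U) (bracket U Z) => a b c d.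
by apply: vfield_eq => p f _; rewrite !vfieldE; ring.
Qed.

Theorem corollary3p4 (R : realType) (n : nat) (M : manifold R n.*2.+1)
    (phi : endo M) (xi : vfield M) (eta : one_form M) (g : metric M)
    (L : plane_field M)
    (nabla hnabla : vfield M -> vfield M -> vfield M)
    (S : vfield M -> vfield M -> vfield M) :
  sasakian n phi xi eta g ->
  flat_legendrian_foliation n eta xi L ->
  completely_integrable n (conjugate_distribution phi L) ->
  bi_legendrian_connection eta xi L (conjugate_distribution phi L) nabla ->
  metric_compatible g nabla ->
  levi_civita g hnabla ->
  (forall V W, S V W = nabla V W - hnabla V W) ->
  [/\ forall V, S V xi = phi V /\ S xi V = phi V,
      forall Z Z', sections (contact_distribution eta) Z ->
        sections (contact_distribution eta) Z' ->
        S Z Z' = ext_d eta Z Z' *: xi,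
      forall X X', sections L X -> sections L X' ->
        nabla X X' = hnabla X X' &
      forall Y Y', sections (conjugate_distribution phi L) Y ->
        sections (conjugate_distribution phi L) Y' ->
        nabla Y Y' = hnabla Y Y'].
Proof.
move=> sas [[_ LD iso] ciL fl] ciQ bi gD lc eS.
have cm := sas.1; have [_ [exi dxi] _ _ _] := cm.
have isoQ := conjugate_isotropic cm LD iso.
have tor U U' : torsion nabla U U' = (ext_d eta U U' *+ 2) *: xi.
  apply: (torsion_bi_legendrian cm U U' bi) => //.
  - by move=> ? ?; exact: completely_integrable_involutive ciL.
  - by move=> ? ?; exact: completely_integrable_involutive ciQ.
  - exact: conjugate_flat sas LD fl.
have SE V W : S V W = ext_d eta V W *: xi + (eta W *: phi V + eta V *: phi W).
  by rewrite eS; exact: levi_civita_contact V W cm gD tor lc.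
have SD Z Z' : eta Z = 0 -> eta Z' = 0 -> S Z Z' = ext_d eta Z Z' *: xi.
  by move=> eZ eZ'; rewrite SE eZ eZ' !scale0r !addr0.
(* Covers both foliations: [S] vanishes on isotropic pairs of contact fields. *)
have iso_eq X X' : eta X = 0 -> eta X' = 0 -> ext_d eta X X' = 0 ->
    nabla X X' = hnabla X X'.
  move=> eX eX' dX; apply/eqP; rewrite -subr_eq0 -eS SD// dX.
  by rewrite scale0r.
split=> [V|Z Z' /eta_sections eZ /eta_sections eZ'|X X' sX sX'|Y Y' sY sY'].
- rewrite !SE ext_dC dxi exi (contact_phi_reeb cm) oppr0 !scale0r !scaler0.
  by rewrite !scale1r !addr0 !add0r.
- exact: SD.
- have LD0 U : sections L U -> eta U = 0.
    by move=> sU; apply/eta_sections => p; exact: LD.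
  by apply: iso_eq; rewrite ?LD0// iso.
- have [X [_ _ e]] := conjugate_sections cm LD sY.
  have [X' [_ _ e']] := conjugate_sections cm LD sY'.
  by apply: iso_eq; rewrite ?(isoQ _ _ sY sY')// ?e ?e' (contact_eta_phi cm).
Qed.
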